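(* Let $h(t)=t$ and let $\psi$ be either $\psi(t)=t$ (''Proposed-$\ell_1$'') or $\psi(t)=1-e^{-t}$ (''Proposed-exp''). Fix $n$ and $\tau\in\mathcal A_n$. Suppose that for each dimension $d$, $Z_1,\ldots,Z_\tau\stackrel{iid}{\sim}F_1$ and, independently, $Z_{\tau+1},\ldots,Z_n\stackrel{iid}{\sim}F_2$, where $F_1=F_{1,d}$ and $F_2=F_{2,d}$ are distributions on $\mathbb{R}^d$ satisfying: (A4) for all $r,s\in\{1,2\}$, if $Z\sim F_r$ and $Z_*\sim F_s$ are independent and $W=Z-Z_*$, then (i) the variables $\psi(|W^{(q)}|)$ have uniformly bounded second moments, and (ii) $\sum_{q\ne q'}\big|\mathrm{Corr}\big(\psi(|W^{(q)}|),\psi(|W^{(q')}|)\big)\big|=o(d^2)$ as $d\to\infty$. Assume also that $\mathcal E_\psi(F_1,F_2)/v_{\psi,d}\to\infty$ as $d\to\infty$. Then: (a) $\mathbb{P}(\widehat T_n^{h,\psi}=\tau)\to1$ as $d\to\infty$. (b) Let $\alpha\in(0,1)$. If $|\mathcal B(\rho_{n,\tau})|/n!\le\alpha$, then the change-point $\tau$ is detected (by $\widehat T_n^{h,\psi}$) at level $\alpha$ with probability converging to one, i.e. $\mathbb{P}(\widehat T^{h,\psi}_n=\tau,\ \widehat S^{h,\psi}_n>\widehat c_{1-\alpha})\to1$ as $d\to\infty$.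
   Context: For $x,y\in\mathbb{R}^d$, $\varphi_{h,\psi}(x,y)=h\big\{\frac1d\sum_{k=1}^d\psi(|x^{(k)}-y^{(k)}|)\big\}$ ($x^{(k)}$ denotes the $k$-th coordinate), which here equals $\frac1d\sum_k\psi(|x^{(k)}-y^{(k)}|)$. $\mathcal E_\psi(F_1,F_2)=\sum_{q=1}^d\big[2\mathbb{E}\psi(|X_1^{(q)}-Y_1^{(q)}|)-\mathbb{E}\psi(|X_1^{(q)}-X_2^{(q)}|)-\mathbb{E}\psi(|Y_1^{(q)}-Y_2^{(q)}|)\big]$, where $X_1,X_2\stackrel{iid}{\sim}F_1$ and $Y_1,Y_2\stackrel{iid}{\sim}F_2$ are independent. For $r,s\in\{1,2\}$, $v^2_{\psi,r,s,d}$ is the asymptotic order of $\mathrm{Var}\big(\sum_{q=1}^d\psi(|Z^{(q)}-Z_*^{(q)}|)\big)$ for independent $Z\sim F_r$, $Z_*\sim F_s$, i.e. a positive sequence whose ratio with this variance is bounded away from $0$ and $\infty$ as $d\to\infty$; $v^2_{\psi,d}=\max\{v^2_{\psi,1,1,d},v^2_{\psi,1,2,d},v^2_{\psi,2,2,d}\}$, $v_{\psi,d}>0$. For $2\le t\le n-2$ define $$T^{h,\psi}_{11}(t)=\binom t2^{-1}\sum_{1\le i<j\le t}\varphi_{h,\psi}(Z_i,Z_j),\quad T^{h,\psi}_{22}(t)=\binom{n-t}2^{-1}\sum_{t+1\le i<j\le n}\varphi_{h,\psi}(Z_i,Z_j),$$ $$T^{h,\psi}_{12}(t)=\frac1{t(n-t)}\sum_{i=1}^{t}\sum_{j=t+1}^{n}\varphi_{h,\psi}(Z_i,Z_j),$$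 $\mathcal D^{h,\psi}_n(t)=\{T^{h,\psi}_{12}(t)-T^{h,\psi}_{11}(t)\}^2+\{T^{h,\psi}_{12}(t)-T^{h,\psi}_{22}(t)\}^2$, and $w(t)=t(n-t)/n^2$. With $\delta_n\in(0,1/2)$ and $m=\lfloor n\delta_n\rfloor$ (usual floor, $m\ge2$ so that everything is defined), $\mathcal A_n=\{m,m+1,\ldots,n-m\}$. Define $\widehat S^{h,\psi}_n=\max_{t\in\mathcal A_n}w(t)\mathcal D^{h,\psi}_n(t)$ and $\widehat T^{h,\psi}_n\in\operatorname{argmax}_{t\in\mathcal A_n}w(t)\mathcal D^{h,\psi}_n(t)$. Permutation test: for a permutation $\pi$ of $\{1,\ldots,n\}$ let $\widehat S_n^{h,\psi,(\pi)}$ be $\widehat S^{h,\psi}_n$ computed from $Z_{\pi(1)},\ldots,Z_{\pi(n)}$, and $\widehat c_{1-\alpha}=\inf\{x\ge 0:\frac1{n!}\sum_\pi \mathbf 1[\widehat S_n^{h,\psi,(\pi)}\le x]\ge1-\alpha\}$. The potential change-point $\widehat T_n^{h,\psi}$ is a detected change-point at level $\alpha$ if $\widehat S^{h,\psi}_n>\widehat c_{1-\alpha}$. Unbalanced permutations: for a permutation $\pi$ and $t\in\mathcal A_n$ let $k_\pi(t)=\#\{i\le t:\pi(i)\le\tau\}$, $p_\pi(t)=k_\pi(t)/t$, $q_\pi(t)=(\tau-k_\pi(t))/(n-t)$. Define $$\rho_{n,\tau}=-2\frac{w(m)}{m-1}+\sqrt{4\Big(\frac{w(m)}{m-1}\Big)^2+2\Big\{w(\tau)-\frac{w(m)}{2(m-1)^2}\Big\}},$$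 $\mathcal B(\rho_{n,\tau})=\{\pi:\max_{t\in\mathcal A_n}|p_\pi(t)-q_\pi(t)|>\rho_{n,\tau}\}$. *)

(* Defs.v *)
From HB Require Import structures.
From mathcomp Require Import all_boot all_order all_algebra perm.
From mathcomp Require Import all_classical all_reals all_analysis.

Set Implicit Arguments.
Unset Strict Implicit.
Unset Printing Implicit Defensive.

Import Order.TTheory GRing.Theory Num.Theory.
Import numFieldNormedType.Exports.

Local Open Scope classical_set_scope.
Local Open Scope ring_scope.

(* Conventions. Points of R^d are d-tuples, with the product sigma-algebra.
   A sample is z : 'I_n -> d.-tuple R, indexed from 0: the first t observations
   are those of index i < t, and the candidate change-point t separates
   {i | i < t} from {i | t <= i}. *)

Section Statistic.
Context {R : realType} {d : nat}.
Variables (h psi : R -> R).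

Definition phi (x y : d.-tuple R) : R :=
  h (d%:R^-1 * \sum_(k < d) psi `|tnth x k - tnth y k|).

Section Sample.
Variables (n : nat) (z : 'I_n -> d.-tuple R).

Definition T11 (t : nat) : R :=
  'C(t, 2)%:R^-1 *
    \sum_(i < n) \sum_(j < n | (i < j < t)%N) phi (z i) (z j).

Definition T22 (t : nat) : R :=
  'C(n - t, 2)%:R^-1 *
    \sum_(i < n) \sum_(j < n | (t <= i < j)%N) phi (z i) (z j).

Definition T12 (t : nat) : R :=
  (t * (n - t))%N%:R^-1 *
    \sum_(i < n | (i < t)%N) \sum_(j < n | (t <= j)%N) phi (z i) (z j).

Definition Dstat (t : nat) : R :=
  (T12 t - T11 t) ^+ 2 + (T12 t - T22 t) ^+ 2.

End Sample.
End Statistic.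

Section Scan.
Context {R : realType}.

Definition weight (n t : nat) : R := (t * (n - t))%N%:R / n%:R ^+ 2.

Definition candidates (n m : nat) : seq nat := index_iota m (n - m).+1.

Definition objective d (h psi : R -> R) n (z : 'I_n -> d.-tuple R) (t : nat) : R :=
  weight n t * Dstat h psi z t.

(* The objective is nonnegative, so the default value 0 does not affect the
   maximum. *)
Definition Shat d (h psi : R -> R) n (m : nat) (z : 'I_n -> d.-tuple R) : R :=
  \big[Num.max/0]_(t <- candidates n m) objective h psi z t.

Definition is_argmax d (h psi : R -> R) n (m : nat) (z : 'I_n -> d.-tuple R)
    (T : nat) : Prop :=
  T \in candidates n m /\
  forall t, t \in candidates n m -> objective h psi z t <= objective h psi z T.

Definition Shat_perm d (h psi : R -> R) n (m : nat) (z : 'I_n -> d.-tuple R)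
    (s : {perm 'I_n}) : R :=
  Shat h psi m (fun i => z (s i)).

(* The critical value at level alpha, i.e. the (1 - alpha)-quantile of the
   permutation distribution. *)
Definition chat d (h psi : R -> R) n (m : nat) (z : 'I_n -> d.-tuple R)
    (alpha : R) : R :=
  inf [set x : R | 0 <= x /\
    1 - alpha <=
      n`!%:R^-1 * \sum_(s : {perm 'I_n}) (Shat_perm h psi m z s <= x)%R%:R].

Definition kperm n (tau : nat) (s : {perm 'I_n}) (t : nat) : nat :=
  #|[pred i : 'I_n | (i < t)%N && (s i < tau)%N]|.

Definition pperm n (tau : nat) (s : {perm 'I_n}) (t : nat) : R :=
  (kperm tau s t)%:R / t%:R.

Definition qperm n (tau : nat) (s : {perm 'I_n}) (t : nat) : R :=
  (tau%:R - (kperm tau s t)%:R) / (n - t)%N%:R.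

Definition rho (n m tau : nat) : R :=
  - 2 * (weight n m / (m%:R - 1)) +
  Num.sqrt (4 * (weight n m / (m%:R - 1)) ^+ 2 +
            2 * (weight n tau - weight n m / (2 * (m%:R - 1) ^+ 2))).

Definition unbalanced (n m tau : nat) (r : R) : {set {perm 'I_n}} :=
  finset (fun s : {perm 'I_n} =>
    r < \big[Num.max/0]_(t <- candidates n m)
          `|pperm tau s t - qperm tau s t|).

End Scan.

Section Populations.
Context {R : realType}.
Variable psi : R -> R.

(* psi(|W^(q)|) for W = Z - Z_*, as a function on the canonical space of the
   pair (Z, Z_* ), whose law is G \x H when Z ~ G and Z_* ~ H are
   independent. *)
Definition psidiff d (q : 'I_d) (x : d.-tuple R * d.-tuple R) : R :=
  psi `|tnth x.1 q - tnth x.2 q|.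

Definition mean_psidiff d (G H : probability (d.-tuple R) R) (q : 'I_d) : R :=
  fine 'E_(G \x H)%E[psidiff q].

Definition energy d (F1 F2 : probability (d.-tuple R) R) : R :=
  \sum_(q < d) (2 * mean_psidiff F1 F2 q - mean_psidiff F1 F1 q
                - mean_psidiff F2 F2 q).

Definition var_sum_psidiff d (G H : probability (d.-tuple R) R) : R :=
  fine 'V_(G \x H)%E[(fun x => \sum_(q < d) psidiff q x)%R].

(* Equal to 0 when one of the variances vanishes. *)
Definition correlation disp (T : measurableType disp) (P : probability T R)
    (X Y : T -> R) : R :=
  fine (covariance P X Y) / Num.sqrt (fine 'V_P[X] * fine 'V_P[Y]).

Definition bounded_second_moments (G H : forall d, probability (d.-tuple R) R) :
    Prop :=
  exists M : R, forall d (q : 'I_d),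
    ('E_(G d \x H d)%E[(fun x => psidiff q x ^+ 2)%R] <= M%:E)%E.

Definition weak_coordinate_dependence
    (G H : forall d, probability (d.-tuple R) R) : Prop :=
  (fun d => \sum_(q < d) \sum_(q' < d | q != q')
     `|correlation (G d \x H d)%E (psidiff q) (psidiff q')| : R^o)
  =o_\oo (fun d => d%:R ^+ 2 : R^o).

(* u is an asymptotic order of v as d -> oo. As v / 0 = 0, the lower bound
   forces v d <> 0 for large d. *)
Definition asymptotic_order (u v : nat -> R) : Prop :=
  (forall d, 0 < u d) /\
  exists c C : R, 0 < c /\ \forall d \near \oo, c <= u d / v d <= C.

(* v_psi, from the orders v2 r s of the variances for F_r and F_s; ord0 stands
   for the population 1 and ord_max for the population 2. *)
Definition vscale (v2 : 'I_2 -> 'I_2 -> nat -> R) (d : nat) : R :=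
  Num.sqrt (Num.max (Num.max (v2 ord0 ord0 d) (v2 ord0 ord_max d))
                    (v2 ord_max ord_max d)).

End Populations.

Section Independence.
Context {R : realType} disp (T : measurableType disp) (P : probability T R).

Definition mutually_independent disp' (T' : measurableType disp') n
    (X : 'I_n -> {RV P >-> T'}) : Prop :=
  forall (J : {set 'I_n}) (A : 'I_n -> set T'), (forall i, measurable (A i)) ->
    P (\bigcap_(i in [set` J]) (X i @^-1` A i)) =
    (\prod_(i in J) P (X i @^-1` A i))%E.

Definition has_law disp' (T' : measurableType disp') (X : {RV P >-> T'})
    (F : probability T' R) : Prop :=
  forall A, measurable A -> distribution P X A = F A.

End Independence.

(* Main.v *)
(** Write a = (mu12 - mu11)/d and b = (mu12 - mu22)/d, where mu_rs is the mean of
    sum_q psi(|W^(q)|), so that a + b is the energy distance divided by d. As the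
    energy dominates the standard deviations, Chebyshev's inequality puts every
    phi(Z_i, Z_j), i < j, within k (a + b) of its mean with probability tending
    to 1, for any fixed k > 0. This reduces everything to the kernel whose entries
    are these means. For it the objective equals w(tau) (a^2 + b^2) at tau; at any
    other candidate a convexity argument gains the factor 1 - 1/n, and for a
    permutation with max_t |p(t) - q(t)| <= rho the quadratic equation solved by
    rho gains w(m) / (4 (m-1)^2) (a^2 + b^2). Since (a + b)^2 <= 2 (a^2 + b^2),
    both gaps survive the perturbation, even when a + b is much smaller than |a|
    and |b|. The test rejects exactly when a proportion at least 1 - alpha of the
    permuted statistics lies strictly below the observed one. *)

Require Import Defs.
From HB Require Import structures.
From mathcomp Require Import all_boot all_order all_algebra perm.
From mathcomp Require Import all_classical all_reals all_analysis measurable_realfun.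
From mathcomp Require Import ring lra zify.

Set Implicit Arguments.
Unset Strict Implicit.
Unset Printing Implicit Defensive.

Import Order.TTheory GRing.Theory Num.Theory.
Import numFieldNormedType.Exports.

Local Open Scope classical_set_scope.
Local Open Scope ring_scope.

(** * Convexity estimates and stability of a quadratic gap under perturbation *)

Section RealInequalities.
Context {R : realType}.
Implicit Types a b s N : R.

(** Convexity of the square at the points [a] and [- b], with defect
    [r * (1 - r) * (a + b) ^+ 2]. *)
Lemma sqr_conv_le (r a b : R) : 0 <= r <= 1 ->
  (r * a - (1 - r) * b) ^+ 2 <= r * a ^+ 2 + (1 - r) * b ^+ 2.
Proof.
move=> /andP[r0 r1]; rewrite -subr_ge0.
have -> : r * a ^+ 2 + (1 - r) * b ^+ 2 - (r * a - (1 - r) * b) ^+ 2 =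
   r * (1 - r) * (a + b) ^+ 2 by ring.
by rewrite mulr_ge0 ?sqr_ge0// mulr_ge0// subr_ge0.
Qed.

(* [N] is the size of the segment containing the change-point and [s] the
   distance from the candidate to it. No sign condition on [a] and [b] is needed,
   by convexity. *)
Lemma shifted_split_le s N a b : 1 <= s -> s <= N - 1 ->
  (N - s) / N * (a ^+ 2 + (b - s / (N - 1) * (a + b)) ^+ 2) <= a ^+ 2 + b ^+ 2.
Proof.
move=> s1 sN.
have N0 : 0 < N by lra.
have N1 : 0 < N - 1 by lra.
set r := s / (N - 1).
have r0 : 0 <= r by rewrite divr_ge0// ?ltW//; lra.
have r1 : r <= 1 by rewrite ler_pdivrMr// mul1r.
have rE : r * (N - 1) = s by rewrite divfK// gt_eqF.
have h : (b - r * (a + b)) ^+ 2 <= r * a ^+ 2 + (1 - r) * b ^+ 2.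
  have := @sqr_conv_le r a b; rewrite r0 r1 => /(_ isT).
  by congr (_ <= _); ring.
rewrite mulrAC ler_pdivrMr//.
apply: (@le_trans _ _ ((N - s) * (a ^+ 2 + (r * a ^+ 2 + (1 - r) * b ^+ 2)))).
  by rewrite ler_wpM2l ?lerD2l//; lra.
rewrite -subr_ge0.
(* The claim is now linear in [a ^+ 2] and [b ^+ 2], and both coefficients are nonnegative; the
   first one equals [r * (s - 1)], which is where [1 <= s] enters. *)
have -> : (a ^+ 2 + b ^+ 2) * N -
    (N - s) * (a ^+ 2 + (r * a ^+ 2 + (1 - r) * b ^+ 2)) =
  a ^+ 2 * (s - r * (N - s)) + b ^+ 2 * (N - (1 - r) * (N - s)) by ring.
have h1 : 0 <= s - r * (N - s).
  have -> : s - r * (N - s) = r * (s - 1) by rewrite -[X in X - _]rE; ring.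
  by rewrite mulr_ge0// subr_ge0.
have h2 : 0 <= N - (1 - r) * (N - s).
  by rewrite subr_ge0 -[leRHS]mul1r ler_pM//; lra.
by rewrite addr_ge0// mulr_ge0 ?sqr_ge0.
Qed.

(** Young's inequality for the cross term [2 * x * (y - x)]; the defect is a perfect square divided
    by [th]. *)
Lemma sqrD_young_le (th x y e : R) : 0 < th -> `|y - x| <= e ->
  y ^+ 2 <= (1 + th) * x ^+ 2 + (1 + th^-1) * e ^+ 2.
Proof.
move=> th0 xye; have e0 : 0 <= e := le_trans (normr_ge0 _) xye.
have h : (y - x) ^+ 2 <= e ^+ 2.
  by rewrite -[leLHS]real_normK ?num_real// ler_sqr ?nnegrE.
have ti : 0 < th^-1 by rewrite invr_gt0.
apply: (@le_trans _ _ ((1 + th) * x ^+ 2 + (1 + th^-1) * (y - x) ^+ 2)); last first.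
  by rewrite lerD2l ler_wpM2l//; lra.
rewrite -subr_ge0.
have -> : (1 + th) * x ^+ 2 + (1 + th^-1) * (y - x) ^+ 2 - y ^+ 2 =
   th^-1 * (th * x - (y - x)) ^+ 2 by field; lra.
by rewrite mulr_ge0 ?sqr_ge0// ltW.
Qed.

(** The errors are small relative to [a + b], whereas the gap [G] is relative to [a ^+ 2 + b ^+ 2].
    Since [(a + b) ^+ 2] is at most twice the latter, the squared error is at most [G ^+ 2 / 100] of
    it, and Young's inequality with parameter [G / 4] on both sides leaves part of the gap. *)
Lemma sqr_gap_stable (w W G k a b x1 x2 y1 y2 a' b' : R) :
  0 <= w <= 1 -> W <= 1 -> 0 < G -> G <= W ->
  0 < a + b -> 0 <= k <= G / 30 ->
  w * (x1 ^+ 2 + x2 ^+ 2) <= (W - G) * (a ^+ 2 + b ^+ 2) ->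
  `|y1 - x1| <= 2 * (k * (a + b)) -> `|y2 - x2| <= 2 * (k * (a + b)) ->
  `|a' - a| <= 2 * (k * (a + b)) -> `|b' - b| <= 2 * (k * (a + b)) ->
  w * (y1 ^+ 2 + y2 ^+ 2) < W * (a' ^+ 2 + b' ^+ 2).
Proof.
move=> /andP[w0 w1] W1 G0 GW ab0 /andP[k0 kG] hx hy1 hy2 ha hb.
set e := 2 * (k * (a + b)) in hy1 hy2 ha hb.
set th := G / 4; have th0 : 0 < th by rewrite /th; lra.
have N0 : 0 < a ^+ 2 + b ^+ 2.
  have : 0 < (a + b) ^+ 2 by rewrite exprn_gt0.
  by have := sqr_ge0 (a - b); rewrite !expr2; lra.
set N := a ^+ 2 + b ^+ 2 in hx N0.
have eN : e ^+ 2 <= G ^+ 2 / 100 * N.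
  have -> : e ^+ 2 = 4 * k ^+ 2 * (a + b) ^+ 2 by rewrite /e; ring.
  have h1 : k ^+ 2 <= G ^+ 2 / 900 by nra.
  have h2 : (a + b) ^+ 2 <= 2 * N.
    by have := sqr_ge0 (a - b); rewrite /N !expr2; lra.
  have h3 : k ^+ 2 * (a + b) ^+ 2 <= G ^+ 2 / 900 * (2 * N).
    by rewrite ler_pM ?sqr_ge0.
  have h4 : 0 <= G ^+ 2 * N by rewrite mulr_ge0 ?sqr_ge0 ?ltW.
  by lra.
have e20 : 0 <= e ^+ 2 := sqr_ge0 _.
have X1 := sqrD_young_le th0 hy1; have X2 := sqrD_young_le th0 hy2.
(* On the larger side the roles are exchanged: bounding [a], [b] by [a'], [b'] yields a lower bound
   for the perturbed value. *)
rewrite distrC in ha; rewrite distrC in hb.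
have A' := sqrD_young_le th0 ha; have B' := sqrD_young_le th0 hb.
have ti : th^-1 = 4 / G by rewrite /th; field; lra.
rewrite ti in X1 X2 A' B'.
set J := (1 + 4 / G) * e ^+ 2 in X1 X2 A' B'.
have G1 : G <= 1 := le_trans GW W1.
have J0 : 0 <= J.
  by rewrite /J mulr_ge0// addr_ge0// divr_ge0// ltW.
have JN : J <= G * N / 20.
  have h : (G + 4) * (e ^+ 2) <= (G * N / 20) * G by nra.
  have -> : J = (G + 4) * e ^+ 2 / G by rewrite /J; field; lra.
  by rewrite ler_pdivrMr.
have L : w * (y1 ^+ 2 + y2 ^+ 2) <= (1 + th) * ((W - G) * N) + 2 * J.
  apply: (@le_trans _ _ (w * ((1 + th) * (x1 ^+ 2 + x2 ^+ 2) + 2 * J))).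
    by rewrite ler_wpM2l//; lra.
  rewrite mulrDr lerD//; last by rewrite ler_piMl//; lra.
  by rewrite mulrCA ler_wpM2l//; lra.
have U : W * N <= (1 + th) * (W * (a' ^+ 2 + b' ^+ 2)) + 2 * J.
  apply: (@le_trans _ _ (W * ((1 + th) * (a' ^+ 2 + b' ^+ 2) + 2 * J))).
    by rewrite ler_wpM2l /N//; lra.
  rewrite mulrDr lerD//; last by rewrite ler_piMl//; lra.
  by rewrite mulrCA.
(* After multiplication by [1 + th], the factor [(1 + th) ^+ 2] leaves [7 / 16] of [G * N], while
   the error terms [2 * J * (2 + th)] cost at most [9 / 40] of it. *)
apply: (le_lt_trans L); rewrite -(ltr_pM2l (_ : 0 < 1 + th)); last by lra.
set V := W * (a' ^+ 2 + b' ^+ 2) in U *.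
apply: (@lt_le_trans _ _ (W * N - 2 * J)); last by lra.
have GN : 0 < G * N by rewrite mulr_gt0.
have thE : (1 + th) ^+ 2 <= 1 + 9 / 16 * G by rewrite /th; nra.
have h5 : 2 * J * (2 + th) <= 9 / 40 * (G * N).
  have h6 : J * (2 + th) <= G * N / 20 * (9 / 4) by apply: ler_pM => //; rewrite /th; lra.
  by lra.
have h7 : (1 + th) ^+ 2 * (W - G) <= W - 7 / 16 * G.
  apply: (@le_trans _ _ ((1 + 9 / 16 * G) * (W - G))).
    by rewrite ler_wpM2r// subr_ge0.
  by nra.
have h8 : (1 + th) ^+ 2 * (W - G) * N <= (W - 7 / 16 * G) * N.
  by rewrite ler_wpM2r// ltW.
by move: h8; rewrite expr2; lra.
Qed.
End RealInequalities.

(** * Averages of a kernel over pairs, and their values for two-class kernels *)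

Section PairAverages.
Context {R : realType} {n : nat}.
Implicit Types (f g : 'I_n -> 'I_n -> R) (A : pred 'I_n) (t : nat).

(** The pair statistics for an arbitrary kernel [f], so that they also apply to the kernel of means
    and to permuted kernels. For [f i j = phi h psi (z i) (z j)] they unfold to [T11], [T22], [T12]
    and [objective]. *)
Definition avg11 f t : R :=
  'C(t, 2)%:R^-1 * \sum_(i < n) \sum_(j < n | (i < j < t)%N) f i j.

Definition avg22 f t : R :=
  'C(n - t, 2)%:R^-1 * \sum_(i < n) \sum_(j < n | (t <= i < j)%N) f i j.

Definition avg12 f t : R :=
  (t * (n - t))%N%:R^-1 *
    \sum_(i < n | (i < t)%N) \sum_(j < n | (t <= j)%N) f i j.

Definition disc f t : R :=
  (avg12 f t - avg11 f t) ^+ 2 + (avg12 f t - avg22 f t) ^+ 2.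

Definition wdisc f t : R := weight n t * disc f t.

(** By symmetry both orders of a pair contribute equally. This trades triangular sums for square
    ones, which factor for a two-class kernel. *)
Lemma sum_pairs_sym A f : (forall i j, f i j = f j i) ->
  2 * (\sum_(i | A i) \sum_(j | A j && (i < j)%N) f i j) =
  (\sum_(i | A i) \sum_(j | A j) f i j) - \sum_(i | A i) f i i.
Proof.
move=> fC; apply/eqP; rewrite eq_sym subr_eq; apply/eqP.
have -> : 2 * (\sum_(i | A i) \sum_(j | A j && (i < j)%N) f i j) =
    (\sum_(i | A i) \sum_(j | A j && (i < j)%N) f i j) +
    (\sum_(i | A i) \sum_(j | A j && (j < i)%N) f i j).
  rewrite mulr_natl mulr2n; congr (_ + _).
  rewrite (exchange_big_dep A) /=; last by move=> i j _ /andP[].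
  by apply: eq_bigr => i Ai; apply: eq_big => [j|j _]; rewrite ?Ai//; exact: fC.
rewrite -!big_split /=; apply: eq_bigr => i Ai.
rewrite (bigD1 i)//= addrC; congr (_ + _).
rewrite (bigID (fun j : 'I_n => (i < j)%N))/=; congr (_ + _); apply: eq_bigl => j.
  by case: (A j) => //=; rewrite -(inj_eq val_inj)/= neq_ltn; case: ltngtP.
by case: (A j) => //=; rewrite -(inj_eq val_inj)/= neq_ltn; case: ltngtP.
Qed.

Lemma natr_bin2 t : 2 * 'C(t, 2)%:R = t%:R * (t%:R - 1) :> R.
Proof.
case: t => [|t]; first by rewrite bin0n mul0r mulr0.
by rewrite -natrM -(mul_bin_diag t.+1 1) bin1 natrM -natr1 addrK.
Qed.

Lemma avg11E f t : (forall i j, f i j = f j i) -> (2 <= t)%N ->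
  avg11 f t = ((\sum_(i < n | (i < t)%N) \sum_(j < n | (j < t)%N) f i j)
               - \sum_(i < n | (i < t)%N) f i i) / (t%:R * (t%:R - 1)).
Proof.
move=> fC t2; rewrite -sum_pairs_sym// /avg11.
have -> : \sum_(i < n) \sum_(j < n | (i < j < t)%N) f i j =
    \sum_(i < n | (i < t)%N) \sum_(j < n | (j < t)%N && (i < j)%N) f i j.
  rewrite [RHS]big_mkcond/=; apply: eq_bigr => i _.
  case: ltnP => it; first by apply: eq_bigl => j; rewrite andbC.
  by rewrite big1// => j /andP[ij jt]; move: (ltn_trans ij jt); rewrite ltnNge it.
rewrite -natr_bin2 mulrC invfM mulrACA divff ?mul1r// pnatr_eq0.
Qed.

Lemma avg22E f t : (forall i j, f i j = f j i) -> (2 <= n - t)%N ->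
  avg22 f t = ((\sum_(i < n | (t <= i)%N) \sum_(j < n | (t <= j)%N) f i j)
               - \sum_(i < n | (t <= i)%N) f i i)
              / ((n - t)%N%:R * ((n - t)%N%:R - 1)).
Proof.
move=> fC t2; rewrite -sum_pairs_sym// /avg22.
have -> : \sum_(i < n) \sum_(j < n | (t <= i < j)%N) f i j =
    \sum_(i < n | (t <= i)%N) \sum_(j < n | (t <= j)%N && (i < j)%N) f i j.
  rewrite [RHS]big_mkcond/=; apply: eq_bigr => i _.
  case: leqP => it; last by rewrite big1.
  apply: eq_bigl => j /=.
  by case: (ltnP i j) => ij; rewrite ?andbF// (leq_trans it (ltnW ij)).
rewrite -natr_bin2 mulrC invfM mulrACA divff ?mul1r// pnatr_eq0.
Qed.

Lemma sum_ltn_const t (c : R) : (t <= n)%N ->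
  \sum_(i < n | (i < t)%N) c = t%:R * c.
Proof.
by move=> tn; rewrite -(big_ord_widen n (fun=> c))// sumr_const card_ord mulr_natl.
Qed.

Lemma sum_geq_const t (c : R) : (t <= n)%N ->
  \sum_(i < n | (t <= i)%N) c = (n - t)%N%:R * c.
Proof.
move=> tn; have : \sum_(i < n) c = n%:R * c by rewrite sumr_const card_ord mulr_natl.
rewrite (bigID (fun i : 'I_n => (i < t)%N))/= sum_ltn_const//.
under eq_bigl do rewrite -leqNgt.
by rewrite natrB// mulrBl => <-; rewrite addrAC subrr add0r.
Qed.

Section TwoClass.
Variables (c : 'I_n -> bool) (M a b : R).

(* The value at (i, j) is M - a if both indices are in class c, M - b if neither
   is, and M otherwise. *)
Definition two_class (i j : 'I_n) : R :=
  M - a * ((c i)%:R * (c j)%:R) - b * ((1 - (c i)%:R) * (1 - (c j)%:R)).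

Lemma two_classC i j : two_class i j = two_class j i.
Proof. by rewrite /two_class; ring. Qed.

Lemma two_class_diag i :
  two_class i i = M - a * (c i)%:R - b * (1 - (c i)%:R).
Proof. by rewrite /two_class; case: (c i) => /=; ring. Qed.

(** The kernel is a sum of products of a function of [i] and a function of [j], so sums over
    rectangles factor into class counts. *)
Lemma sum_two_class (A B : pred 'I_n) :
  \sum_(i | A i) \sum_(j | B j) two_class i j =
  M * ((\sum_(i | A i) 1) * (\sum_(i | B i) 1))
  - a * ((\sum_(i | A i) (c i)%:R) * (\sum_(i | B i) (c i)%:R))
  - b * ((\sum_(i | A i) 1 - \sum_(i | A i) (c i)%:R) *
         (\sum_(i | B i) 1 - \sum_(i | B i) (c i)%:R)).
Proof.
rewrite -!sumrB !mulr_suml !mulr_sumr -!sumrB; apply: eq_bigr => i _.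
by rewrite !mulr_sumr -!sumrB; apply: eq_bigr => j _; rewrite /two_class !mulr1.
Qed.

Lemma sum_two_class_diag (A : pred 'I_n) :
  \sum_(i | A i) two_class i i =
  M * (\sum_(i | A i) 1) - a * (\sum_(i | A i) (c i)%:R)
  - b * (\sum_(i | A i) 1 - \sum_(i | A i) (c i)%:R).
Proof.
rewrite -!sumrB !mulr_sumr -!sumrB; apply: eq_bigr => i _.
by rewrite two_class_diag mulr1.
Qed.

Variable t : nat.
Hypotheses (t2 : (2 <= t)%N) (nt2 : (2 <= n - t)%N).
Let T : R := t%:R.
Let N : R := (n - t)%N%:R.
Let p : R := (\sum_(i < n | (i < t)%N) (c i)%:R) / T.
Let q : R := (\sum_(i < n | (t <= i)%N) (c i)%:R) / N.

Let tn : (t <= n)%N.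
Proof. by rewrite ltnW// -subn_gt0 (leq_trans _ nt2). Qed.
Let T2 : 2 <= T. Proof. by rewrite (ler_nat _ 2%N). Qed.
Let N2 : 2 <= N. Proof. by rewrite (ler_nat _ 2%N). Qed.

(** Among pairs of distinct indices left of [t], the proportion with both in class [c] is
    [p ^+ 2 - p * (1 - p) / (T - 1)], as in sampling without replacement. The same correction
    affects the other class, hence the term in [a + b]. *)
Lemma avg12B11_two_class : avg12 two_class t - avg11 two_class t =
  (p - q) * (p * a - (1 - p) * b) - p * (1 - p) / (T - 1) * (a + b).
Proof.
rewrite avg11E//; last exact: two_classC.
rewrite /avg12 !sum_two_class sum_two_class_diag !sum_ltn_const// !sum_geq_const//.
rewrite natrM -/T -/N !mulr1.
rewrite /p /q; set k := \sum_(i < n | (i < t)%N) _; set l := \sum_(i < n | (t <= i)%N) _.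
by have := T2; have := N2; rewrite /T /N => ? ?; field; lra.
Qed.

Lemma avg12B22_two_class : avg12 two_class t - avg22 two_class t =
  (q - p) * (q * a - (1 - q) * b) - q * (1 - q) / (N - 1) * (a + b).
Proof.
rewrite avg22E//; last exact: two_classC.
rewrite /avg12 !sum_two_class sum_two_class_diag !sum_ltn_const// !sum_geq_const//.
rewrite natrM -/T -/N !mulr1.
rewrite /p /q; set k := \sum_(i < n | (i < t)%N) _; set l := \sum_(i < n | (t <= i)%N) _.
by have := T2; have := N2; rewrite /T /N => ? ?; field; lra.
Qed.

End TwoClass.

(** Each average has nonnegative weights of total 1 and involves off-diagonal entries only. *)
Lemma avg_close f g (e : R) t : (2 <= t)%N -> (2 <= n - t)%N ->
  (forall i j, i != j -> `|f i j - g i j| <= e) ->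
  [/\ `|avg11 f t - avg11 g t| <= e, `|avg22 f t - avg22 g t| <= e &
      `|avg12 f t - avg12 g t| <= e].
Proof.
move=> t2 nt2 fg.
have tn : (t <= n)%N by rewrite ltnW// -subn_gt0 (leq_trans _ nt2).
pose z (_ : 'I_n) := false.
have T2 : 2 <= t%:R :> R by rewrite (ler_nat _ 2%N).
have N2 : 2 <= (n - t)%N%:R :> R by rewrite (ler_nat _ 2%N).
have t0 : 0 < t%:R * (t%:R - 1) :> R by rewrite mulr_gt0//; lra.
have n0 : 0 < (n - t)%N%:R * ((n - t)%N%:R - 1) :> R by rewrite mulr_gt0//; lra.
(* The total weight is read off by evaluating the same average on the constant kernel [e]. *)
have close (k e' : R) (D : 'I_n -> 'I_n -> bool) : 0 <= k ->
    (forall i j, D i j -> i != j) ->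
    k * \sum_(i < n) \sum_(j < n | D i j) e = e' ->
    `|k * (\sum_(i < n) \sum_(j < n | D i j) f i j) -
      k * (\sum_(i < n) \sum_(j < n | D i j) g i j)| <= e'.
  move=> k0 Dij <-.
  rewrite -mulrBr normrM ger0_norm// ler_wpM2l//.
  rewrite -sumrB (le_trans (ler_norm_sum _ _ _))//; apply: ler_sum => i _.
  rewrite -sumrB (le_trans (ler_norm_sum _ _ _))//; apply: ler_sum => j ij.
  exact/fg/Dij.
split.
- apply: close => [|i j|]; first by rewrite invr_ge0.
    by case/andP => + _; apply: contraTneq => ->; rewrite ltnn.
  rewrite -/(avg11 (fun _ _ => e) t) avg11E// !sum_ltn_const//.
  by field; lra.
- apply: close => [|i j|]; first by rewrite invr_ge0.
    by case/andP => _; apply: contraTneq => ->; rewrite ltnn.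
  rewrite -/(avg22 (fun _ _ => e) t) avg22E// !sum_geq_const//.
  by field; lra.
rewrite /avg12.
have E (F : 'I_n -> 'I_n -> R) :
    \sum_(i < n | (i < t)%N) \sum_(j < n | (t <= j)%N) F i j =
    \sum_(i < n) \sum_(j < n | (i < t)%N && (t <= j)%N) F i j.
  rewrite [LHS]big_mkcond; apply: eq_bigr => i _ /=.
  by case: ifP => // _; rewrite big_pred0_eq.
rewrite !E; apply: close => [|i j|]; first by rewrite invr_ge0.
  by case/andP => it tj; apply: contraTneq it => ->; rewrite -leqNgt.
rewrite -E sum_geq_const// sum_ltn_const// natrM; field; lra.
Qed.

End PairAverages.

(** * Bound on one squared difference when the two proportions are close *)

Section BalancedInequality.
Context {R : realType}.

(* [x] is the inverse of the segment size minus 1, [c] and [c2] are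
   w(m)/(m-1) and w(m)/(m-1)^2. *)
Lemma balanced_term_le (w x c c2 r p q a b : R) : 0 <= w <= 1 / 4 -> 0 <= x ->
  w * x <= c -> w * x ^+ 2 <= c2 -> 0 <= p <= 1 -> `|p - q| <= r ->
  w * ((p - q) * (p * a - (1 - p) * b) - p * (1 - p) * x * (a + b)) ^+ 2 <=
  (r ^+ 2 / 4 + r * c + c2 / 8) * (a ^+ 2 + b ^+ 2).
Proof.
move=> /andP[w0 w4] x0 wx wx2 p01 pq.
set u := p * a - (1 - p) * b; set N := a ^+ 2 + b ^+ 2.
have uN : u ^+ 2 <= N.
  apply: (le_trans (sqr_conv_le a b p01)); case/andP: p01 => p0 p1.
  by rewrite lerD// ler_piMl ?sqr_ge0//; lra.
have EN : (a + b) ^+ 2 <= 2 * N.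
  by have := sqr_ge0 (a - b); rewrite /N !expr2; lra.
have N0 : 0 <= N := le_trans (sqr_ge0 u) uN.
have r0 : 0 <= r := le_trans (normr_ge0 _) pq.
have v0 : 0 <= p * (1 - p) by case/andP: p01 => p0 p1; rewrite mulr_ge0//; lra.
have v4 : p * (1 - p) <= 1 / 4 by have := sqr_ge0 (p - 1 / 2); rewrite expr2; lra.
set v := p * (1 - p) in v0 v4 *.
have xy (y z : R) : `|y * z| <= (y ^+ 2 + z ^+ 2) / 2.
  rewrite normrM -(real_normK (num_real y)) -(real_normK (num_real z)).
  by have := sqr_ge0 (`|y| - `|z|); rewrite !expr2; lra.
(* With [v <= 1 / 4], [|u * (a + b)| <= 3 / 2 * N] and [(a + b) ^+ 2 <= 2 * N], the cross term gets
   [2 * (1 / 4) * (3 / 2) = 3 / 4] and the last term [2 / 16 = 1 / 8]. The factor [3 / 4] is later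
   rounded up to 1, to match the quadratic solved by [rho]. *)
have h1 : ((p - q) * u - v * x * (a + b)) ^+ 2 <=
   r ^+ 2 * N + 3 / 4 * r * x * N + x ^+ 2 * N / 8.
  have -> : ((p - q) * u - v * x * (a + b)) ^+ 2 =
     (p - q) ^+ 2 * u ^+ 2 + (- (2 * v * x * ((p - q) * (u * (a + b))))) +
     (v ^+ 2 * x ^+ 2) * (a + b) ^+ 2 by ring.
  have pq2 : (p - q) ^+ 2 <= r ^+ 2.
    by rewrite -(real_normK (num_real (p - q))) ler_sqr ?nnegrE.
  have ub : `|u * (a + b)| <= 3 / 2 * N by apply: (le_trans (xy _ _)); lra.
  apply: lerD; first apply: lerD.
  - by rewrite ler_pM ?sqr_ge0.
  - apply: (le_trans (ler_norm _)); rewrite normrN normrM ger0_norm; last first.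
      by rewrite mulr_ge0// mulr_ge0.
    rewrite [leRHS](_ : _ = (2 * (1 / 4) * x) * (r * (3 / 2 * N))); last by field.
    apply: ler_pM => //; first by rewrite mulr_ge0// mulr_ge0.
      by rewrite ler_wpM2r// ler_wpM2l.
    by rewrite normrM ler_pM.
  - rewrite [leRHS](_ : _ = ((1 / 4) ^+ 2 * x ^+ 2) * (2 * N)); last by field.
    apply: ler_pM => //; [by rewrite mulr_ge0 ?sqr_ge0|exact: sqr_ge0|].
    rewrite ler_wpM2r ?sqr_ge0//.
    by rewrite ler_sqr ?nnegrE//; lra.
apply: (le_trans (ler_wpM2l w0 h1)).
have -> : w * (r ^+ 2 * N + 3 / 4 * r * x * N + x ^+ 2 * N / 8) =
  (w * r ^+ 2 + 3 / 4 * (r * (w * x)) + (w * x ^+ 2) / 8) * N by ring.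
rewrite ler_wpM2r//.
have h2 : w * r ^+ 2 <= r ^+ 2 / 4.
  by rewrite mulrC ler_wpM2l ?sqr_ge0//; lra.
have h3 : r * (w * x) <= r * c by rewrite ler_wpM2l.
have h4 : 0 <= r * (w * x) by rewrite !mulr_ge0.
lra.
Qed.
End BalancedInequality.

(** * Monotonicity of the weights, and the quadratic equation behind [rho] *)

Section Weights.
Context {R : realType}.
Variables (n m : nat).
Hypothesis m2 : (2 <= m)%N.

Lemma mem_candidates t : (t \in candidates n m) = (m <= t)%N && (t <= n - m)%N.
Proof. by rewrite /candidates mem_index_iota ltnS. Qed.

Lemma weightE t : (t <= n)%N ->
  weight n t = t%:R * (n%:R - t%:R) / n%:R ^+ 2 :> R.
Proof. by move=> tn; rewrite /weight natrM natrB. Qed.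

Lemma weight_gt0 t : t \in candidates n m -> 0 < weight n t :> R.
Proof.
rewrite mem_candidates => /andP[mt tnm].
rewrite /weight divr_gt0// ?exprn_gt0// ltr0n ?muln_gt0; last by lia.
by apply/andP; split; lia.
Qed.

Lemma weight_le t : t \in candidates n m -> weight n t <= 1 / 4 :> R.
Proof.
rewrite mem_candidates => /andP[mt tnm].
have n0 : 0 < n%:R :> R by rewrite ltr0n; lia.
rewrite weightE; last by lia.
rewrite ler_pdivrMr ?exprn_gt0//.
by have := sqr_ge0 (n%:R - 2 * t%:R :> R); rewrite !expr2; lra.
Qed.

(** Both [x / (x - 1)] and [k - x] decrease in [x]; the smallest candidate [m] is therefore the
    extreme case below. *)
Let weight_div_aux (x y k : R) : 2 <= y -> y <= x -> x <= k ->
  x * (k - x) / (x - 1) <= y * (k - y) / (y - 1).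
Proof.
move=> y2 yx xk; rewrite ler_pdivrMr; last by lra.
rewrite mulrAC ler_pdivlMr; last by lra.
rewrite mulrAC [leRHS]mulrAC ler_pM ?mulr_ge0//; lra.
Qed.

Lemma weight_div_le t : t \in candidates n m ->
  weight n t / (t%:R - 1) <= weight n m / (m%:R - 1) :> R.
Proof.
rewrite mem_candidates => /andP[mt tnm].
have M2 : 2 <= m%:R :> R by rewrite (ler_nat _ 2%N).
have MT : m%:R <= t%:R :> R by rewrite ler_nat.
have TN : t%:R <= n%:R :> R by rewrite ler_nat; lia.
rewrite !weightE; try lia.
rewrite mulrAC [leRHS]mulrAC ler_wpM2r ?invr_ge0 ?exprn_ge0//.
exact: weight_div_aux.
Qed.

Lemma weight_div2_le t : t \in candidates n m ->
  weight n t / (t%:R - 1) ^+ 2 <= weight n m / (m%:R - 1) ^+ 2 :> R.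
Proof.
move=> tc; have wt := weight_gt0 tc; have := weight_div_le tc.
move: tc; rewrite mem_candidates => /andP[mt tnm] h.
have M2 : 2 <= m%:R :> R by rewrite (ler_nat _ 2%N).
have MT : m%:R <= t%:R :> R by rewrite ler_nat.
rewrite !expr2 !invfM !mulrA; apply: ler_pM => //.
- by rewrite divr_ge0 ?(ltW wt)//; lra.
- by rewrite invr_ge0; lra.
- by rewrite lef_pV2 ?posrE; lra.
Qed.

Lemma weight_sym t : (t <= n)%N -> weight n (n - t) = weight n t :> R.
Proof. by move=> tn; rewrite /weight subKn// mulnC. Qed.

Lemma candidates_sym t : t \in candidates n m -> (n - t)%N \in candidates n m.
Proof. by rewrite !mem_candidates => /andP[mt tnm]; apply/andP; split; lia. Qed.

(** [rho] is the root [- 2 * c + Num.sqrt (4 * c ^+ 2 + 2 * K)] of [r ^+ 2 / 2 + 2 * c * r = K]. *)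
Lemma rho_quadratic tau : (m <= n - m)%N -> 0 <= rho n m tau :> R ->
  rho n m tau ^+ 2 / 2 + 2 * (weight n m / (m%:R - 1) * rho n m tau) =
  weight n tau - weight n m / (2 * (m%:R - 1) ^+ 2) :> R.
Proof.
move=> mnm.
have M2 : 2 <= m%:R :> R by rewrite (ler_nat _ 2%N).
have wm : 0 < weight n m :> R.
  by apply: weight_gt0; rewrite mem_candidates leqnn.
rewrite /rho; set K := weight n tau - _; set c := weight n m / (m%:R - 1).
have c0 : 0 < c by rewrite divr_gt0//; lra.
case: (leP 0 (4 * c ^+ 2 + 2 * K)) => s0.
  have := sqr_sqrtr s0; set S := Num.sqrt _ => + _.
  have -> : (- 2 * c + S) ^+ 2 / 2 + 2 * (c * (- 2 * c + S)) =
     (S ^+ 2 - 4 * c ^+ 2) / 2 by field.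
  by move=> ->; field.
(* A negative radicand has square root 0 by convention; then [rho] is [- 2 * c < 0], which is
   excluded. *)
by rewrite ltr0_sqrtr//; lra.
Qed.

End Weights.

(** * The deterministic gap of the scan statistic for the kernel of means and its perturbations *)

Section ScanGap.
Context {R : realType}.
Variables (n m tau : nat).
Hypotheses (m2 : (2 <= m)%N) (htau : tau \in candidates n m).
Implicit Types (s : {perm 'I_n}) (t : nat) (M a b : R).

Definition before (i : 'I_n) := (i < tau)%N.

Let taun : (tau <= n)%N.
Proof. by move: htau; rewrite mem_candidates => /andP[]; lia. Qed.

Let cand_bounds t : t \in candidates n m ->
  [/\ (2 <= t)%N, (2 <= n - t)%N & (t <= n)%N].
Proof. by rewrite mem_candidates => /andP[mt tnm]; split; lia. Qed.

Lemma sum_before_ltn s t :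
  \sum_(i < n | (i < t)%N) (before (s i))%:R = (kperm tau s t)%:R :> R.
Proof.
rewrite /kperm -sum1_card natr_sum big_mkcond [RHS]big_mkcond.
apply: eq_bigr => i _; rewrite inE /before.
by case: (i < t)%N; case: (s i < tau)%N.
Qed.

Lemma sum_before_geq s t :
  \sum_(i < n | (t <= i)%N) (before (s i))%:R = tau%:R - (kperm tau s t)%:R :> R.
Proof.
have : \sum_(i < n) (before (s i))%:R = tau%:R :> R.
  rewrite -(reindex_inj (h := s) (P := xpredT) (F := fun i => (before i)%:R)) /=.
    rewrite -[RHS]mulr1 -(sum_ltn_const (n := n))// [RHS]big_mkcond/=.
    by apply: eq_bigr => i _; rewrite /before; case: ifP.
  exact: perm_inj.
rewrite (bigID (fun i : 'I_n => (i < t)%N))/= sum_before_ltn => <-.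
by under [X in _ = _ + X - _]eq_bigl do rewrite -leqNgt; rewrite addrAC subrr add0r.
Qed.

Lemma pperm01 s t : (t <= n)%N -> 0 <= (pperm tau s t : R) <= 1.
Proof.
move=> tn; rewrite /pperm -sum_before_ltn.
have s0 : 0 <= \sum_(i < n | (i < t)%N) (before (s i))%:R :> R.
  by apply: sumr_ge0.
rewrite divr_ge0//=.
case: t tn s0 => [|t] tn s0; first by rewrite invr0 mulr0.
rewrite ler_pdivrMr ?ltr0n// mul1r -[leRHS]mulr1 -(sum_ltn_const (n := n))//.
by apply: ler_sum => i _; case: (before _).
Qed.

Lemma qperm01 s t : (t <= n)%N -> 0 <= (qperm tau s t : R) <= 1.
Proof.
move=> tn; rewrite /qperm -sum_before_geq.
have s0 : 0 <= \sum_(i < n | (t <= i)%N) (before (s i))%:R :> R.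
  by apply: sumr_ge0.
rewrite divr_ge0//=.
have [->|N0] := eqVneq (n - t)%N 0%N; first by rewrite invr0 mulr0.
rewrite ler_pdivrMr ?ltr0n ?lt0n// mul1r -[leRHS]mulr1 -(sum_geq_const (n := n))//.
by apply: ler_sum => i _; case: (before _).
Qed.

(** Permuting the observations only permutes the classes: the kernel is again two-class, for
    [before (s i)], with proportions [pperm] and [qperm]. *)
Lemma disc_two_class s M a b t : (2 <= t)%N -> (2 <= n - t)%N ->
  let p := pperm tau s t in let q := qperm tau s t in
  disc (fun i j => two_class before M a b (s i) (s j)) t =
  ((p - q) * (p * a - (1 - p) * b) - p * (1 - p) / (t%:R - 1) * (a + b)) ^+ 2 +
  ((q - p) * (q * a - (1 - q) * b)
     - q * (1 - q) / ((n - t)%N%:R - 1) * (a + b)) ^+ 2.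
Proof.
move=> t2 nt2 /=.
rewrite -[LHS]/(disc (two_class (fun i => before (s i)) M a b) t) /disc.
rewrite avg12B11_two_class// avg12B22_two_class//.
by rewrite !sum_before_ltn !sum_before_geq.
Qed.

Lemma kperm1_le t : (t <= tau)%N -> kperm tau (1%g : {perm 'I_n}) t = t.
Proof.
move=> tt; apply/eqP; rewrite -(eqr_nat R) -sum_before_ltn; apply/eqP.
rewrite -[RHS]mulr1 -(sum_ltn_const (n := n)) ?(leq_trans tt)//.
by apply: eq_bigr => i it; rewrite perm1 /before (leq_trans it).
Qed.

Lemma kperm1_ge t : (tau <= t)%N -> kperm tau (1%g : {perm 'I_n}) t = tau.
Proof.
move=> tt; apply/eqP; rewrite -(eqr_nat R) -sum_before_ltn; apply/eqP.
rewrite -[RHS]mulr1 -(sum_ltn_const (n := n))//.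
rewrite big_mkcond [RHS]big_mkcond; apply: eq_bigr => i _; rewrite perm1 /before.
by case: (ltnP i tau) => it; rewrite ?(leq_trans it tt)//; case: ifP.
Qed.

Lemma disc_two_class1 M a b t : (2 <= t)%N -> (2 <= n - t)%N ->
  let p := pperm tau (1%g : {perm 'I_n}) t in let q := qperm tau (1%g : {perm 'I_n}) t in
  disc (two_class before M a b) t =
  ((p - q) * (p * a - (1 - p) * b) - p * (1 - p) / (t%:R - 1) * (a + b)) ^+ 2 +
  ((q - p) * (q * a - (1 - q) * b)
     - q * (1 - q) / ((n - t)%N%:R - 1) * (a + b)) ^+ 2.
Proof.
move=> t2 nt2 /=; rewrite -(disc_two_class _ M)//.
by congr disc; apply/funext => i; apply/funext => j; rewrite !perm1.
Qed.

(** At [tau] both segments are pure, [p = 1] and [q = 0], so the corrections for distinct indices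
    vanish. *)
Lemma avg_at_change M a b (g := two_class before M a b) :
  avg12 g tau - avg11 g tau = a /\ avg12 g tau - avg22 g tau = b.
Proof.
have [tau2 ntau2 _] := cand_bounds htau.
rewrite avg12B11_two_class// avg12B22_two_class//.
have sum1 (A : pred 'I_n) : \sum_(i | A i) (before i)%:R =
    \sum_(i | A i) (before ((1%g : {perm 'I_n}) i))%:R :> R.
  by apply: eq_bigr => i _; rewrite perm1.
rewrite !sum1 sum_before_ltn sum_before_geq kperm1_le// subrr mul0r divff;
  last by rewrite pnatr_eq0; lia.
by split; ring.
Qed.

(** One segment is pure and the other mixed. The discrepancy carries the square of a proportion
    [(N - s) / N], with [N] the size of the mixed segment: one factor is absorbed by the weight, the
    other is handled by [shifted_split_le]. The gain [1 - n%:R^-1] comes from integrality. *)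
Lemma wdisc_off_change M a b t : t \in candidates n m -> t != tau ->
  wdisc (two_class before M a b) t <=
  (weight n tau - weight n tau / n%:R) * (a ^+ 2 + b ^+ 2).
Proof.
move=> tc ttau; have [t2 nt2 tn] := cand_bounds tc.
have [tau2 ntau2 _] := cand_bounds htau.

rewrite /wdisc; have := disc_two_class1 M a b t2 nt2.
rewrite /= /pperm /qperm natrB//; move: (disc _ t) => D DE; set Q := a ^+ 2 + b ^+ 2.
have T2 : 2 <= t%:R :> R by rewrite (ler_nat _ 2%N).
have U2 : 2 <= tau%:R :> R by rewrite (ler_nat _ 2%N).
have N2 : 2 <= (n - t)%N%:R :> R by rewrite (ler_nat _ 2%N).
have NU2 : 2 <= (n - tau)%N%:R :> R by rewrite (ler_nat _ 2%N).
rewrite !weightE//; move: N2 NU2; rewrite !natrB// => N2 NU2.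
have n0 : 0 < n%:R :> R by lra.
have Q0 : 0 <= Q by rewrite addr_ge0 ?sqr_ge0.
suff H : t%:R * (n%:R - t%:R) * D <=
    (tau%:R * (n%:R - tau%:R)) * (1 - n%:R^-1) * Q.
  rewrite [leRHS](_ : _ = (tau%:R * (n%:R - tau%:R)) * (1 - n%:R^-1) * Q / n%:R ^+ 2).
    by rewrite mulrAC ler_wpM2r// invr_ge0 sqr_ge0.
  by field; rewrite gt_eqF.
(* Used with [t < tau] in one case and with [n - t < n - tau] in the other. *)
have tpred (x y : R) : x + 1 <= y -> 0 <= y <= n%:R -> x <= y * (1 - n%:R^-1).
  move=> xy /andP[y0 yn].
  have : y / n%:R <= 1 by rewrite ler_pdivrMr// mul1r.
  by rewrite mulrBr mulr1; lra.
case: (ltngtP t tau) => [tlt|tgt|teq]; last by rewrite teq eqxx in ttau.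
- have TU : t%:R + 1 <= tau%:R :> R by rewrite natr1 ler_nat.
  rewrite kperm1_le ?(ltnW tlt)// in DE.
  have := @shifted_split_le _ (tau%:R - t%:R) (n%:R - t%:R) a b.
  set L := (X in _ -> _ -> X <= _) => hL.
  have -> : t%:R * (n%:R - t%:R) * D = (n%:R - tau%:R) * (t%:R * L).
    by rewrite DE /L; field; lra.
  rewrite [leRHS](_ : _ =
    (n%:R - tau%:R) * ((tau%:R * (1 - n%:R^-1)) * Q)); last by ring.
  rewrite ler_wpM2l//; first by lra.
  apply: ler_pM; [lra| |by apply: tpred; lra|by apply: hL; lra].
  by rewrite /L mulr_ge0 ?addr_ge0 ?sqr_ge0// divr_ge0; lra.
- have TU : tau%:R + 1 <= t%:R :> R by rewrite natr1 ler_nat.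
  rewrite kperm1_ge ?(ltnW tgt)// in DE.
  (* The mixed segment is now the left one, so [a] and [b] change places. *)
  have := @shifted_split_le _ (t%:R - tau%:R) t%:R b a.
  set L := (X in _ -> _ -> X <= _) => hL.
  have -> : t%:R * (n%:R - t%:R) * D = (n%:R - t%:R) * (tau%:R * L).
    by rewrite DE /L; field; lra.
  rewrite [leRHS](_ : _ = (n%:R - tau%:R) * (1 - n%:R^-1) * (tau%:R * Q)); last by ring.
  apply: ler_pM; [lra| |by apply: tpred; lra|].
    rewrite /L mulr_ge0 ?ler0n// mulr_ge0 ?addr_ge0 ?sqr_ge0// divr_ge0; lra.
  rewrite ler_wpM2l//.
  by rewrite /Q [leRHS]addrC; apply: hL; lra.
Qed.

(** With [c = w(m) / (m - 1)] and [c2 = w(m) / (m - 1)^2], [balanced_term_le] on the two segments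
    gives the total [rho^2 / 2 + 2 * c * rho + c2 / 4]. By [rho_quadratic] this is
    [w(tau) - c2 / 2 + c2 / 4]. *)
Lemma wdisc_balanced M a b s t : t \in candidates n m ->
  s \notin unbalanced n m tau (rho n m tau : R) ->
  wdisc (fun i j => two_class before M a b (s i) (s j)) t <=
  (weight n tau - weight n m / (4 * (m%:R - 1) ^+ 2)) * (a ^+ 2 + b ^+ 2).
Proof.
move=> tc; rewrite finset.inE -leNgt => hs; have [t2 nt2 tn] := cand_bounds tc.
(* The maximum defining [unbalanced] starts from 0, so a negative [rho] would make every permutation
   unbalanced. *)
have r0 : 0 <= rho n m tau :> R := le_trans (bigmax_ge_id _ _ _ _) hs.
have pq : `|pperm tau s t - qperm tau s t| <= rho n m tau :> R.
  by apply: le_trans hs; apply: (le_bigmax_seq 0 t xpredT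
    (fun u => `|pperm tau s u - qperm tau s u| : R)).
rewrite /wdisc disc_two_class//.
have M2 : 2 <= m%:R :> R by rewrite (ler_nat _ 2%N).
have T2 : 2 <= t%:R :> R by rewrite (ler_nat _ 2%N).
have N2 : 2 <= (n - t)%N%:R :> R by rewrite (ler_nat _ 2%N).
have w4 : 0 <= (weight n t : R) <= 1 / 4.
  by rewrite (weight_le m2 tc) andbT ltW// (weight_gt0 m2 tc).
have mnm : (m <= n - m)%N by move: tc; rewrite mem_candidates; lia.
have tc' := candidates_sym m2 tc.
have hX := @balanced_term_le _ (weight n t) (t%:R - 1)^-1 _ _ _ _ _ a b w4 _
  (weight_div_le m2 tc) _ (pperm01 s tn) pq.
rewrite distrC in pq.
have hY := @balanced_term_le _ (weight n t) ((n - t)%N%:R - 1)^-1 _ _ _ _ _ a b w4 _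
  _ _ (qperm01 s tn) pq.
rewrite mulrDr.
apply: (le_trans (lerD (hX (weight n m / (m%:R - 1) ^+ 2) _ _)
  (hY (weight n m / (m%:R - 1)) (weight n m / (m%:R - 1) ^+ 2) _ _ _))).
- by rewrite invr_ge0; lra.
- by rewrite exprVn (weight_div2_le m2 tc).
- by rewrite invr_ge0; lra.
- by rewrite -(weight_sym tn) (weight_div_le m2 tc').
- by rewrite -(weight_sym tn) exprVn (weight_div2_le m2 tc').
rewrite -mulrDl ler_wpM2r ?addr_ge0 ?sqr_ge0//.
have := rho_quadratic m2 mnm r0; rewrite [in LHS](mulrC _ (rho _ _ _)).
have -> : weight n m / (2 * (m%:R - 1) ^+ 2) =
  weight n m / (m%:R - 1) ^+ 2 / 2 :> R by field; lra.
have -> : weight n m / (4 * (m%:R - 1) ^+ 2) =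
  weight n m / (m%:R - 1) ^+ 2 / 4 :> R by field; lra.
lra.
Qed.

(** The tolerance [k] is fixed before the kernel and its parameters, so that a single value serves
    all dimensions. *)
Lemma scan_gap : exists k : R, 0 < k /\
  forall M a b (f : 'I_n -> 'I_n -> R), 0 < a + b ->
    (forall i j, i != j -> `|f i j - two_class before M a b i j| <= k * (a + b)) ->
    (forall t, t \in candidates n m -> t != tau -> wdisc f t < wdisc f tau) /\
    (forall s t, t \in candidates n m ->
       s \notin unbalanced n m tau (rho n m tau : R) ->
       wdisc (fun i j => f (s i) (s j)) t < wdisc f tau).
Proof.
pose W : R := weight n tau.
(* The smaller of the gains at other candidates and for balanced permutations; [sqr_gap_stable] then
   allows the tolerance [G / 30]. *)
pose G := Num.min (W / n%:R) (weight n m / (4 * (m%:R - 1) ^+ 2)).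
have [tau2 ntau2 _] := cand_bounds htau.
have M2 : 2 <= m%:R :> R by rewrite (ler_nat _ 2%N).
have mc : m \in candidates n m.
  by move: htau; rewrite !mem_candidates; lia.
have n1 : 1 <= n%:R :> R by rewrite (ler_nat _ 1%N); lia.
have W0 : 0 < W := weight_gt0 m2 htau.
have W4 : W <= 1 / 4 := weight_le m2 htau.
have G0 : 0 < G.
  rewrite lt_min; apply/andP; split; first by rewrite divr_gt0//; lra.
  apply: divr_gt0; first exact: weight_gt0 mc.
  by rewrite mulr_gt0// exprn_gt0//; lra.
have GW : G <= W.
  rewrite ge_min; apply/orP; left; rewrite ler_pdivrMr; last by lra.
  by rewrite ler_peMr// ltW.
exists (G / 30); split; first by rewrite divr_gt0.
move=> M a b f ab0 fg.
set g := two_class before M a b in fg *.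
pose e := G / 30 * (a + b).
have dist2 (u v u' v' : R) : `|u' - u| <= e -> `|v' - v| <= e ->
    `|(u' - v') - (u - v)| <= 2 * e.
  move=> hu hv; have -> : (u' - v') - (u - v) = (u' - u) - (v' - v) by ring.
  by apply: (le_trans (ler_normB _ _)); lra.
have Q0 : 0 <= a ^+ 2 + b ^+ 2 by rewrite addr_ge0 ?sqr_ge0.
have k0 : 0 <= G / 30 <= G / 30 by rewrite lexx andbT divr_ge0// ltW.
have W1 : W <= 1 by lra.
have [f11 f22 f12] := avg_close tau2 ntau2 fg.
have gap (f' g' : 'I_n -> 'I_n -> R) t : t \in candidates n m ->
    (forall i j, i != j -> `|f' i j - g' i j| <= e) ->
    wdisc g' t <= (W - G) * (a ^+ 2 + b ^+ 2) -> wdisc f' t < wdisc f tau.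
  move=> tc fg' hg; have [t2 nt2 tn] := cand_bounds tc.
  have w01 : 0 <= (weight n t : R) <= 1.
    by have := weight_le (R := R) m2 tc; have := weight_gt0 (R := R) m2 tc; lra.
  have [f11' f22' f12'] := avg_close t2 nt2 fg'.
  have [ga gb] := avg_at_change M a b.
  apply: (@sqr_gap_stable _ _ W G (G / 30) a b _ _ _ _ _ _ w01 W1 G0 GW
     ab0 k0 hg); rewrite -/e.
  - exact: dist2.
  - exact: dist2.
  - by rewrite -[X in _ - X]ga; apply: dist2.
  - by rewrite -[X in _ - X]gb; apply: dist2.
split=> [t tc ttau|s t tc hs].
- apply: (gap f g) => //; apply: le_trans (wdisc_off_change M a b tc ttau) _.
  by rewrite ler_wpM2r// lerD2l lerN2 ge_min lexx.
- apply: (gap _ (fun i j => g (s i) (s j))) => // [i j ij|].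
    by apply: fg; rewrite (inj_eq perm_inj).
  apply: le_trans (wdisc_balanced M a b tc hs) _.
  by rewrite ler_wpM2r// lerD2l lerN2 ge_min lexx orbT.
Qed.
End ScanGap.

(** * Integrability and Chebyshev's inequality for sums over coordinates *)

Lemma bounded_sqr_integrable disp (T : measurableType disp) (R : realType)
    (P : probability T R) (X : T -> R) (B : R) :
  measurable_fun setT X -> ('E_P[(fun x => X x ^+ 2)%R] <= B%:E)%E ->
  P.-integrable setT (EFin \o X).
Proof.
move=> mX XB.
have mX2 : measurable_fun setT (fun x => X x ^+ 2) by exact: measurable_funX.
apply: (@le_integrable _ _ _ _ _ measurableT _ (EFin \o (fun x => 1 + X x ^+ 2))).
- exact/measurable_EFinP.
- move=> x _ /=; rewrite lee_fin.
  rewrite [leRHS]ger0_norm ?addr_ge0 ?sqr_ge0//.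
  rewrite -[X in _ <= 1 + X]real_normK ?num_real//.
  by have := sqr_ge0 (1 - `|X x|); rewrite !expr2; nra.
rewrite [X in _.-integrable _ X](_ : _ = (fun x => 1%:E + (X x ^+ 2)%:E)%E)//.
apply: integrableD => //.
  exact: (finite_measure_integrable_cst P 1).
apply/integrableP; split; first exact/measurable_EFinP.
move: XB; rewrite unlock.
under [X in (X < _)%E]eq_integral do rewrite gee0_abs ?lee_fin ?sqr_ge0//.
by move/le_lt_trans; apply; rewrite ltry.
Qed.

Section Psidiff.
Context {R : realType}.
Variable psi : R -> R.
Hypothesis mpsi : measurable_fun setT psi.

Lemma measurable_psidiff d (q : 'I_d) : measurable_fun setT (psidiff psi q).
Proof.
apply: measurableT_comp => //; apply: measurableT_comp => //.
apply: measurable_funB.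
- apply: (measurableT_comp (f := fun x : d.-tuple R => tnth x q)) => //.
  exact: measurable_tnth.
- apply: (measurableT_comp (f := fun x : d.-tuple R => tnth x q)) => //.
  exact: measurable_tnth.
Qed.

Lemma measurable_sum_psidiff d :
  measurable_fun setT (fun x : d.-tuple R * d.-tuple R => \sum_(q < d) psidiff psi q x).
Proof. by apply: measurable_sum => q; exact: measurable_psidiff. Qed.

Section Product.
Variables (d : nat) (G H : probability (d.-tuple R) R).
Variable B : R.
Hypothesis bounded : forall q : 'I_d,
  ('E_(G \x H)%E[(fun x => psidiff psi q x ^+ 2)%R] <= B%:E)%E.

Lemma integrable_psidiff (q : 'I_d) :
  (G \x H)%E.-integrable setT (EFin \o psidiff psi q).
Proof. exact: (bounded_sqr_integrable (measurable_psidiff q) (bounded q)). Qed.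

Lemma mean_sum_psidiff :
  fine 'E_(G \x H)%E[(fun x => \sum_(q < d) psidiff psi q x)%R] =
  \sum_(q < d) mean_psidiff psi G H q.
Proof.
rewrite unlock; under eq_integral do rewrite -sumEFin.
rewrite integral_sum//; last by move=> q; exact: integrable_psidiff.
rewrite -sum_fine => [|q _]; last first.
  exact: integrable_fin_num (integrable_psidiff q).
by apply: eq_bigr => q _; rewrite /mean_psidiff unlock.
Qed.

(** Since [fine] sends an infinite variance to 0, the nonvanishing of [var_sum_psidiff] ensures that
    the variance is finite. *)
Lemma chebyshev_sum_psidiff (e : R) : 0 < e -> var_sum_psidiff psi G H != 0 ->
  ((G \x H) [set x | (e <= `|\sum_(q < d) psidiff psi q x -
                            \sum_(q < d) mean_psidiff psi G H q|)%R] <=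
   (e ^- 2 * var_sum_psidiff psi G H)%:E)%E.
Proof.
move=> e0 v0.
have := @chebyshev _ _ _ (G \x H)%E
  (mfun_Sub (mem_set (@measurable_sum_psidiff d))) e e0.
rewrite /= mean_sum_psidiff EFinM.
move/le_trans; apply; rewrite lee_pmul2l// ?lte_fin ?invr_gt0 ?exprn_gt0//.
move: v0; rewrite /var_sum_psidiff; set V := 'V_ _ [ _ ].
have : (0 <= V)%E := variance_ge0 _ _.
by case: V => [r| |]//; rewrite eqxx.
Qed.

End Product.
End Psidiff.

(** * The law of a pair of independent observations *)

Section JointLaw.
Context {R : realType} disp (Om : measurableType disp) (P : probability Om R).
Context disp' (T : measurableType disp') (n : nat).
Variables (X : 'I_n -> {RV P >-> T}) (i j : 'I_n) (G H : probability T R).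

Lemma measurable_pairRV : measurable_fun setT (fun w => (X i w, X j w)).
Proof. exact/measurable_fun_pair. Qed.

(** Independence over the index set of [i] and [j] gives agreement on measurable rectangles, which
    determines the product measure. *)
Lemma joint_law (A : set (T * T)) :
  mutually_independent X -> i != j -> has_law (X i) G -> has_law (X j) H ->
  measurable A -> P ((fun w => (X i w, X j w)) @^-1` A) = (G \x H)%E A.
Proof.
move=> indep ij lawi lawj mA.
pose Y := mfun_Sub (mem_set measurable_pairRV) : {RV P >-> (T * T)%type}.
rewrite (@product_measure_unique _ _ _ _ _ _ _ (distribution P Y))// => C D mC mD.
pose E k := if k == i then C else D.
have := indep [set i; j]%SET E.
have Ei : E i = C by rewrite /E eqxx.
have Ej : E j = D by rewrite /E eq_sym (negbTE ij).
rewrite big_setU1/= ?inE// big_set1 Ei Ej.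
have -> : \bigcap_(k in [set` [set i; j]%SET]) X k @^-1` E k = Y @^-1` (C `*` D).
  apply/seteqP; split=> w /=.
    by move=> h; split; [have := h i|have := h j];
      rewrite /= ?Ei ?Ej !inE eqxx ?orbT; apply.
  by move=> [wC wD] k /=; rewrite !inE => /orP[|] /eqP ->; rewrite ?Ei ?Ej.
rewrite -(lawi _ mC) -(lawj _ mD) => <-// k.
by rewrite /E; case: ifP.
Qed.

End JointLaw.

(** * Union bound, convergence of probabilities to 1, and tails as the dimension grows *)

Lemma measure_bigsetU_le disp (T : measurableType disp) (R : realType)
    (mu : {measure set T -> \bar R}) (I : Type) (r : seq I) (A : I -> set T) :
  (forall i, measurable (A i)) ->
  (mu (\big[setU/set0]_(i <- r) A i) <= \sum_(i <- r) mu (A i))%E.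
Proof.
move=> mA; elim: r => [|i r IH]; first by rewrite !big_nil measure0.
rewrite !big_cons; apply: le_trans (measureU2 _ _ _) _ => //.
  exact: bigsetU_measurable.
by rewrite leeD2l.
Qed.

Lemma cvg_probability1 (R : realType) (disp : nat -> measure_display)
    (Om : forall d, measurableType (disp d)) (P : forall d, probability (Om d) R)
    (A : forall d, set (Om d)) :
  (forall d, measurable (A d)) ->
  (forall e : R, 0 < e -> \forall d \near \oo, ((1 - e)%:E <= P d (A d))%E) ->
  (fun d => P d (A d)) @ \oo --> 1%E.
Proof.
move=> mA h.
have fP d : P d (A d) \is a fin_num by rewrite fin_num_measure.
apply/fine_cvgP; split; first by near=> d.
apply/cvgrPdist_le => e e0; near=> d => /=.
have h1 : ((1 - e)%:E <= P d (A d))%E by near: d; exact: h.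
have h2 : (P d (A d) <= 1)%E by exact: probability_le1.
move: (fP d) h1 h2 => /fineK <-; rewrite !lee_fin => h1 h2.
by rewrite ger0_norm; lra.
Unshelve. all: by end_near. Qed.

(** Chebyshev bounds the tail by [V / (k * D) ^+ 2]; as [c * V <= u <= v ^+ 2], this is at most
    [(v / D) ^+ 2 / (c * k ^+ 2)], which tends to 0. *)
Lemma sum_psidiff_tail (R : realType) (psi : R -> R)
    (G H : forall d, probability (d.-tuple R) R) (u v D : nat -> R) (k e : R) :
  measurable_fun setT psi -> bounded_second_moments psi G H ->
  asymptotic_order u (fun d => var_sum_psidiff psi (G d) (H d)) ->
  (forall d, 0 < v d /\ u d <= v d ^+ 2) -> (fun d => D d / v d) @ \oo --> +oo ->
  0 < k -> 0 < e ->
  \forall d \near \oo,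
    ((G d \x H d) [set x | (k * D d <= `|\sum_(q < d) psidiff psi q x -
                            \sum_(q < d) mean_psidiff psi (G d) (H d) q|)%R] <=
     e%:E)%E.
Proof.
move=> mpsi [B bound] [u0 [c [C [c0 order]]]] uv /cvgryPge Dv k0 e0.
near=> d.
have [v0 uv2] := uv d.
have ck0 : 0 < c * k ^+ 2 * e by rewrite !mulr_gt0 ?exprn_gt0.
have /andP[cu _] : c <= u d / var_sum_psidiff psi (G d) (H d) <= C.
  by near: d.
(* The summand 1 gives [x <= x ^+ 2] for the ratio [x], and the other one then gives
   [1 <= c * k ^+ 2 * e * x ^+ 2]. *)
have Dd : 1 + (c * k ^+ 2 * e)^-1 <= D d / v d by near: d; exact: Dv.
set V := var_sum_psidiff psi (G d) (H d) in cu *.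
have V0 : V != 0.
  by apply: contraTneq cu => ->; rewrite invr0 mulr0 -ltNge.
have Vge0 : 0 <= V by rewrite /V /var_sum_psidiff fine_ge0// variance_ge0.
have Vgt0 : 0 < V by rewrite lt_neqAle eq_sym V0.
have cV : c * V <= v d ^+ 2.
  by apply: le_trans uv2; rewrite -ler_pdivlMr.
have i0 : 0 < (c * k ^+ 2 * e)^-1 by rewrite invr_gt0.
set x := D d / v d in Dd.
have D0 : 0 < D d.
  by have : 0 < x by [lra]; rewrite /x pmulr_lgt0// invr_gt0.
have kD : 0 < k * D d by rewrite mulr_gt0.
apply: (le_trans (@chebyshev_sum_psidiff _ _ mpsi _ _ _ B _ _ kD V0)) => //.
rewrite lee_fin -/V mulrC ler_pdivrMr ?exprn_gt0//.
have x2 : 1 <= (c * k ^+ 2 * e) * x ^+ 2.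
  rewrite mulrC -ler_pdivrMr// div1r; apply: (@le_trans _ _ x); first by lra.
  by rewrite expr2 ler_peMr//; lra.
have DE : D d = x * v d by rewrite /x divfK// gt_eqF.
rewrite -(ler_pM2l c0); apply: (le_trans cV).
rewrite DE [leRHS](_ : _ = c * k ^+ 2 * e * x ^+ 2 * v d ^+ 2); last by ring.
by rewrite ler_peMl// sqr_ge0.
Unshelve. all: by end_near. Qed.

(** * Quantiles of a finite family *)

Section Quantile.
Context {R : realType} (S : finType) (X : S -> R) (alpha y : R).
Hypotheses (X0 : forall s, 0 <= X s) (S0 : (0 < #|S|)%N) (alpha01 : 0 < alpha < 1).

Let freq (A : pred S) : R := #|S|%:R^-1 * \sum_(s : S) (A s)%:R.

Let freq_le (A B : pred S) : (forall s, A s -> B s) -> freq A <= freq B.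
Proof.
move=> AB; rewrite /freq ler_wpM2l// ler_sum// => s _.
by case: (A s) (AB s) => [-> //|_]; rewrite ler0n.
Qed.

(** A quantile lies strictly below [y] exactly when the values strictly below [y] already have
    frequency [1 - alpha]. Finiteness matters: the largest such value is still less than [y]. *)
Lemma quantile_lt :
  inf [set x : R | 0 <= x /\
    1 - alpha <= #|S|%:R^-1 * \sum_(s : S) (X s <= x)%R%:R] < y <->
  1 - alpha <= #|S|%:R^-1 * \sum_(s : S) (X s < y)%R%:R.
Proof.
have /andP[a0 a1] := alpha01.
set Q := [set x : R | _]; split=> [|h].
  move/inf_lt => /(_ _)[|x [x0 hx] xy].
    (* The set is nonempty: the sum dominates every [X s], so the frequency there is 1. *)
    exists (\sum_s X s); split; first exact: sumr_ge0.
    rewrite (eq_bigr (fun=> 1)) => [|s _].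
      by rewrite sumr_const mulVf ?pnatr_eq0 -?lt0n//; lra.
    by rewrite (bigD1 s)//= lerDl sumr_ge0.
  by apply: (le_trans hx); apply: freq_le => s /le_lt_trans; apply.
(* The default 0 is also below [y]: some [X s] is, as otherwise the frequency would be
   [0 < 1 - alpha]. *)
pose x0 : R := \big[Num.max/0]_(s | X s < y) X s.
have x0y : x0 < y.
  apply/bigmax_ltP; split=> //.
  have [s sy|none] := pickP (fun s => X s < y).
    exact: le_lt_trans (X0 s) sy.
  move: h; rewrite big1 => [|s _]; last by rewrite none.
  by rewrite mulr0; lra.
apply: le_lt_trans x0y; apply: ge_inf; first by exists 0 => x [].
split; first exact: bigmax_ge_id.
apply: (le_trans h); apply: freq_le => s sy.
exact: (le_bigmax_cond 0 (P := fun s => X s < y) X).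
Qed.

End Quantile.

(** * Measurability of the scan statistic *)

Section ScanMeasurability.
Context {R : realType} (h psi : R -> R).
Hypotheses (mh : measurable_fun setT h) (mpsi : measurable_fun setT psi).
Context disp (Om : measurableType disp) (n d : nat).
Variable z : Om -> 'I_n -> d.-tuple R.
Hypothesis mz : forall i, measurable_fun setT (fun w => z w i).

Lemma measurable_phi i j : measurable_fun setT (fun w => phi h psi (z w i) (z w j)).
Proof.
apply: measurableT_comp => //.
apply: measurable_funM => //; apply: measurable_sum => k.
have mk l : measurable_fun setT (fun w => tnth (z w l) k).
  apply: (measurableT_comp (f := fun x : d.-tuple R => tnth x k)) => //.
  exact: measurable_tnth.
do 2 apply: measurableT_comp => //.
exact: measurable_funB.
Qed.

Lemma measurable_objective t :
  measurable_fun setT (fun w => objective h psi (z w) t).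
Proof.
apply: measurable_funM => //.
have mS (I : seq 'I_n) (A : pred 'I_n) (F : 'I_n -> Om -> R) :
    (forall i, measurable_fun setT (F i)) ->
    measurable_fun setT (fun w => \sum_(i <- I | A i) F i w).
  move=> mF; under eq_fun do rewrite big_mkcond/=.
  by apply: measurable_sum => i; case: (A i).
have m11 : measurable_fun setT (fun w => T11 h psi (z w) t).
  by apply: measurable_funM => //; do 2 apply: (mS) => ?; exact: measurable_phi.
have m22 : measurable_fun setT (fun w => T22 h psi (z w) t).
  by apply: measurable_funM => //; do 2 apply: (mS) => ?; exact: measurable_phi.
have m12 : measurable_fun setT (fun w => T12 h psi (z w) t).
  by apply: measurable_funM => //; do 2 apply: (mS) => ?; exact: measurable_phi.
by apply: measurable_funD; apply: measurable_funX; apply: measurable_funB.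
Qed.

Lemma measurable_Shat m : measurable_fun setT (fun w => Shat h psi m (z w)).
Proof.
rewrite /Shat; elim: (candidates n m) => [|t r IH].
  by under eq_fun do rewrite big_nil; exact: measurable_cst.
under eq_fun do rewrite big_cons.
by apply: measurable_maxr => //; exact: measurable_objective.
Qed.

End ScanMeasurability.

(** * The rejection event of the permutation test *)

Section Rejection.
Context {R : realType} (h psi : R -> R) (n m : nat) (alpha : R).
Hypothesis alpha01 : 0 < alpha < 1.

Lemma Shat_ge0 d (z : 'I_n -> d.-tuple R) : 0 <= Shat h psi m z.
Proof. exact: bigmax_ge_id. Qed.

Lemma chat_ltP d (z : 'I_n -> d.-tuple R) :
  chat h psi m z alpha < Shat h psi m z <->
  1 - alpha <= n`!%:R^-1 *
    \sum_(s : {perm 'I_n}) (Shat_perm h psi m z s < Shat h psi m z)%R%:R.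
Proof.
have cardS : #|{perm 'I_n}| = n`! by exact: card_Sn.
rewrite /chat -cardS; apply: quantile_lt => //.
- by move=> s; exact: Shat_ge0.
- by rewrite cardS fact_gt0.
Qed.

(** By [chat_ltP] the event compares a finite sum of indicators with a constant, so the infimum in
    [chat] needs no measurability argument. *)
Lemma measurable_chat_lt d disp (Om : measurableType disp)
    (z : Om -> 'I_n -> d.-tuple R) :
  measurable_fun setT h -> measurable_fun setT psi ->
  (forall i, measurable_fun setT (fun w => z w i)) ->
  measurable [set w | chat h psi m (z w) alpha < Shat h psi m (z w)].
Proof.
move=> mh mpsi mz.
pose g w : R := n`!%:R^-1 *
  \sum_(s : {perm 'I_n}) (Shat_perm h psi m (z w) s < Shat h psi m (z w))%R%:R.
have mg : measurable_fun setT g.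
  apply: measurable_funM => //; apply: measurable_sum => s.
  apply: (measurableT_comp (f := fun b : bool => b%:R : R)) => //.
  apply: measurable_fun_ltr; last exact: measurable_Shat.
  exact: (@measurable_Shat _ h psi mh mpsi _ _ _ _ (fun w i => z w (s i))).
rewrite (_ : [set w | _] = (fun w => 1 - alpha <= g w) @^-1` [set true]).
  have := measurable_fun_ler (measurable_cst (1 - alpha)) mg.
  by move=> /(_ measurableT [set true] I); rewrite setTI.
by apply/seteqP; split=> w /=; move/chat_ltP.
Qed.

(** Every permutation outside [bad] counts towards the frequency in [chat_ltP], and these form a
    proportion at least [1 - alpha]. *)
Lemma chat_lt_of_bad d (z : 'I_n -> d.-tuple R) (bad : {set {perm 'I_n}}) :
  #|bad|%:R / n`!%:R <= alpha ->
  (forall s, s \notin bad -> Shat_perm h psi m z s < Shat h psi m z) ->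
  chat h psi m z alpha < Shat h psi m z.
Proof.
move=> badle good; apply/chat_ltP.
have cardS : #|{perm 'I_n}| = n`! by exact: card_Sn.
have n0 : 0 < n`!%:R :> R by rewrite ltr0n fact_gt0.
rewrite mulrC ler_pdivlMr// mulrBl mul1r lerBlDr -cardS.
move: badle; rewrite ler_pdivrMr// -cardS => badle.
apply: (@le_trans _ _
  (\sum_(s : {perm 'I_n}) (Shat_perm h psi m z s < Shat h psi m z)%R%:R + #|bad|%:R)).
  rewrite -!sum1_card !natr_sum [X in _ <= _ + X]big_mkcond -big_split/=.
  apply: ler_sum => s _; case: ifPn => [_|/good ->].
    by rewrite lerDr ler0n.
  by rewrite addr0.
by rewrite lerD2l.
Qed.

End Rejection.

(** * From typical samples to the limit in the dimension *)

Theorem theorem5 (R : realType) (h psi : R -> R)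
  (hh : h = (fun t => t))
  (hpsi : psi = (fun t => t) \/ psi = (fun t => 1 - expR (- t)))
  (n : nat) (delta : R) (hdelta : 0 < delta < 1 / 2)
  (m : nat) (hm : m = Num.truncn (n%:R * delta)) (hm2 : (2 <= m)%N)
  (tau : nat) (htau : tau \in candidates n m)
  (F : 'I_2 -> forall d : nat, probability (d.-tuple R) R)
  (disp : nat -> measure_display)
  (Omega : forall d : nat, measurableType (disp d))
  (P : forall d : nat, probability (Omega d) R)
  (Z : forall d : nat, 'I_n -> {RV (P d) >-> d.-tuple R})
  (hindep : forall d, mutually_independent (Z d))
  (hlaw : forall d (i : 'I_n),
     has_law (Z d i) (F (if (i < tau)%N then ord0 else ord_max) d))
  (hmoment : forall r s, bounded_second_moments psi (F r) (F s))
  (hcorr : forall r s, weak_coordinate_dependence psi (F r) (F s))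
  (v2 : 'I_2 -> 'I_2 -> nat -> R)
  (hv2 : forall r s,
     asymptotic_order (v2 r s) (fun d => var_sum_psidiff psi (F r d) (F s d)))
  (henergy : (fun d => energy psi (F ord0 d) (F ord_max d) / vscale v2 d)
               @ \oo --> +oo)
  (That : forall d : nat, {RV (P d) >-> nat})
  (hThat : forall d w, is_argmax h psi m (fun i => Z d i w) (That d w)) :
  (fun d => P d [set w | That d w = tau]) @ \oo --> 1%E
  /\
  (forall alpha : R, 0 < alpha < 1 ->
     #|unbalanced n m tau (rho n m tau : R)|%:R / n`!%:R <= alpha ->
     (fun d => P d [set w | That d w = tau /\
        chat h psi m (fun i => Z d i w) alpha < Shat h psi m (fun i => Z d i w)])
       @ \oo --> 1%E).
Proof.
have mpsi : measurable_fun setT psi.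
  case: hpsi => ->; first exact: measurable_id.
  apply: measurable_funB => //.
  by apply: measurableT_comp => //; exact: measurable_expR.
have mh : measurable_fun setT h by rewrite hh; exact: measurable_id.
have mZ d i : measurable_fun setT (Z d i) by exact: measurable_funPT.
pose cls (i : 'I_n) : 'I_2 := if (i < tau)%N then ord0 else ord_max.
pose mu r s d : R := \sum_(q < d) mean_psidiff psi (F r d) (F s d) q.
pose D d : R := energy psi (F ord0 d) (F ord_max d).
have DE d : D d = 2 * mu ord0 ord_max d - mu ord0 ord0 d - mu ord_max ord_max d.
  by rewrite /D /energy /mu mulr_sumr -!sumrB.
have v_gt0 d : 0 < vscale v2 d.
  by rewrite sqrtr_gt0 !lt_max (hv2 ord0 ord0).1.
(* For [i < j] the pair of populations (2, 1) cannot occur; its order does not enter [vscale]. *)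
have v2_le (i j : 'I_n) d : (i < j)%N -> v2 (cls i) (cls j) d <= vscale v2 d ^+ 2.
  move=> ij; have := v_gt0 d; rewrite {1}/vscale sqrtr_gt0 => /ltW max0.
  rewrite /vscale sqr_sqrtr// /cls.
  case: ltnP => it; case: ltnP => jt; try by rewrite !le_max lexx ?orbT.
  by move: (leq_ltn_trans it (ltn_trans ij jt)); rewrite ltnn.
have [k [k0 gap]] := scan_gap (R := R) hm2 htau.
pose dev d (i j : 'I_n) w : R :=
  `|\sum_(q < d) psidiff psi q (Z d i w, Z d j w) - mu (cls i) (cls j) d|.
(* The empty set for the remaining pairs lets the union bound range over the whole finite type. *)
pose bad d (p : 'I_n * 'I_n) : set (Omega d) :=
  if (p.1 < p.2)%N then [set w | k * D d <= dev d p.1 p.2 w] else set0.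
pose atypical d (i j : 'I_n) : set (d.-tuple R * d.-tuple R) :=
  [set x | k * D d <= `|\sum_(q < d) psidiff psi q x - mu (cls i) (cls j) d|].
have matypical d i j : measurable (atypical d i j).
  have mS : measurable_fun setT (fun x : d.-tuple R * d.-tuple R =>
      `|\sum_(q < d) psidiff psi q x - mu (cls i) (cls j) d|).
    apply: measurableT_comp => //; apply: measurable_funB => //.
    exact: measurable_sum_psidiff.
  have := measurable_fun_ler (measurable_cst (k * D d)) mS.
  by move=> /(_ measurableT [set true] I); rewrite setTI.
have badE d (p : 'I_n * 'I_n) : (p.1 < p.2)%N ->
    bad d p = (fun w => (Z d p.1 w, Z d p.2 w)) @^-1` atypical d p.1 p.2.
  by move=> pp; rewrite /bad pp.
have mbad d p : measurable (bad d p).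
  case: (ltnP p.1 p.2) => pp; last by rewrite /bad ltnNge pp; exact: measurable0.
  rewrite badE// -[X in measurable X]setTI.
  exact: (measurable_pairRV (Z d) p.1 p.2 measurableT (matypical d p.1 p.2)).
have bad_small (e : R) : 0 < e ->
    \forall d \near \oo, forall p, (P d (bad d p) <= e%:E)%E.
  move=> e0; apply: filter_forall => p.
  case: (ltnP p.1 p.2) => pp; last first.
    by near=> d; rewrite /bad ltnNge pp/= measure0 lee_fin ltW.
  have tail := sum_psidiff_tail mpsi (hmoment (cls p.1) (cls p.2))
    (hv2 (cls p.1) (cls p.2))
    (fun d => conj (v_gt0 d) (v2_le _ _ d pp)) henergy k0 e0.
  near=> d; rewrite badE// (joint_law (hindep d) _ (hlaw d p.1) (hlaw d p.2))//.
  - by near: d; exact: tail.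
  - by apply: contraTneq pp => ->; rewrite ltnn.
  - exact: matypical.
pose good d w :=
  (forall t, t \in candidates n m -> t != tau ->
     objective h psi (fun i => Z d i w) t < objective h psi (fun i => Z d i w) tau) /\
  (forall s t, t \in candidates n m -> s \notin unbalanced n m tau (rho n m tau : R) ->
     objective h psi (fun i => Z d (s i) w) t < objective h psi (fun i => Z d i w) tau).
have good_of_typical d w : (0 < d)%N -> 0 < D d ->
    (forall p, ~ bad d p w) -> good d w.
  move=> d0 D0 typ.
  pose r : R := d%:R^-1.
  have r0 : 0 < r by rewrite invr_gt0 ltr0n.
  pose f i j := phi h psi (Z d i w) (Z d j w).
  have fC i j : f i j = f j i.
    by rewrite /f /phi; under eq_bigr do rewrite distrC.
  (* Scaling by [r = d%:R^-1] turns coordinate sums into values of [phi]; the parameters [a] and [b]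
     then add up to [r * D d]. *)
  have := @gap (r * mu ord0 ord_max d) (r * (mu ord0 ord_max d - mu ord0 ord0 d))
    (r * (mu ord0 ord_max d - mu ord_max ord_max d)) f.
  rewrite -mulrDr.
  have -> : mu ord0 ord_max d - mu ord0 ord0 d +
      (mu ord0 ord_max d - mu ord_max ord_max d) = D d by rewrite DE; ring.
  rewrite mulr_gt0//; set g := two_class _ _ _ _.
  (* Only pairs with [i < j] are controlled; the symmetry of both kernels covers the others. *)
  suff fg (i j : 'I_n) : (i < j)%N -> `|f i j - g i j| <= k * (r * D d).
    apply=> // i j; rewrite -(inj_eq val_inj)/= neq_ltn => /orP[/fg//|ji].
    by rewrite fC /g two_classC; exact: fg.
  move=> ij; have -> : g i j = r * mu (cls i) (cls j) d.
    rewrite /g /two_class /before /cls.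
    case: ltnP => it; case: ltnP => jt /=; try ring.
    by move: (leq_ltn_trans it (ltn_trans ij jt)); rewrite ltnn.
  have -> : f i j = r * \sum_(q < d) psidiff psi q (Z d i w, Z d j w).
    by rewrite /f /phi hh.
  rewrite -mulrBr normrM (gtr0_norm r0) mulrCA ler_wpM2l ?(ltW r0)//.
  have := typ (i, j); rewrite /bad /= ij /= => /negP; rewrite -ltNge.
  exact: ltW.
(* Measurability is asked of [A] rather than of [good]; the lower bound on its probability comes
   from the complement of the union of the bad events. *)
have cvg_good (A : forall d, set (Omega d)) : (forall d, measurable (A d)) ->
    (forall d w, good d w -> A d w) -> (fun d => P d (A d)) @ \oo --> 1%E.
  move=> mA goodA; apply: cvg_probability1 => // e e0.
  have N0 : 0 < (#|{: 'I_n * 'I_n}|.+1)%:R :> R by rewrite ltr0n.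
  have small := bad_small (e / (#|{: 'I_n * 'I_n}|.+1)%:R) (divr_gt0 e0 N0).
  have D_gt0 : \forall d \near \oo, 0 < D d.
    have /cvgryPgt Dv := henergy; near=> d.
    have : 0 < energy psi (F ord0 d) (F ord_max d) / vscale v2 d.
      by near: d; exact: Dv.
    by rewrite pmulr_lgt0// invr_gt0.
  near=> d.
  pose B := \big[setU/set0]_(p : 'I_n * 'I_n) bad d p.
  have mB : measurable B by apply: bigsetU_measurable.
  have PB : (P d B <= e%:E)%E.
    apply: (le_trans (measure_bigsetU_le _ _ (mbad d))).
    apply: (@le_trans _ _ (\sum_(p : 'I_n * 'I_n)
      (e / (#|{: 'I_n * 'I_n}|.+1)%:R)%:E)%E).
      by apply: lee_sum => p _; move: p; near: d; exact: small.
    rewrite sumEFin lee_fin sumr_const -[leLHS]mulr_natr mulrAC ler_pdivrMr//.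
    by rewrite ler_wpM2l ?ler_nat// ltW.
  have BA : ~` B `<=` A d.
    move=> w nB; apply/goodA/good_of_typical.
    - by near: d; exists 1%N.
    - by near: d.
    - by move=> p bp; apply: nB; rewrite /B (bigD1 p)//=; left.
  apply: (@le_trans _ _ (P d (~` B))).
    rewrite probability_setC// EFinB leeB//.
  by apply: le_measure; rewrite ?inE//; exact: measurableC.
(* The maximum at [tau] is strict, so the choice among maximizers is immaterial. *)
have That_eq d w : good d w -> That d w = tau.
  move=> [best _]; have [Tc Tmax] := hThat d w; apply/eqP; apply: contraT => ne.
  by have := best _ Tc ne; rewrite ltNge Tmax.
have mThat d : measurable [set w | That d w = tau].
  rewrite -[X in measurable X]setTI.
  exact: (measurable_funPT (That d) measurableT [set tau]).
split; first exact: cvg_good.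
move=> alpha alpha01 unb; apply: cvg_good => [d|d w gw].
  by apply: measurableI => //; exact: measurable_chat_lt.
split; first exact: That_eq.
apply: (chat_lt_of_bad alpha01 unb) => s sbal.
have [_ perm_lt] := gw.
(* The maximum in [Shat_perm] starts from 0, so the objective at [tau] must be shown positive: it
   strictly exceeds a nonnegative permuted value. *)
have tau_lt := perm_lt s tau htau sbal.
apply: (@lt_le_trans _ _ (objective h psi (fun i => Z d i w) tau)).
  rewrite /Shat_perm /Shat big_seq; apply: bigmax_lt.
    apply: le_lt_trans tau_lt; apply: mulr_ge0.
      exact: ltW (weight_gt0 hm2 htau).
    by rewrite addr_ge0 ?sqr_ge0.
  by move=> t tc; exact: perm_lt.
exact: (le_bigmax_seq 0 tau xpredT (objective h psi (fun i => Z d i w))).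
Unshelve. all: by end_near. Qed.
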